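(* Let $\mathcal{A}$ and $\mathcal{B}$ be balanced categories with epimorphic images, and let $T:\mathcal{B}\to\mathcal{A}$ be left adjoint to $H:\mathcal{A}\to\mathcal{B}$ with unit $\eta:\mathbf{1}_{\mathcal{B}}\to H\circ T$. The following are equivalent: (i) The pair of adjoint functors $T\dashv H$ induces mutually inverse equivalences $\mathcal{C}_H\rightleftarrows\mathcal{G}^T$. (ii) $\eta_Y:Y\to(H\circ T)(Y)$ is an epimorphism for all $Y\in\mathcal{B}$.
   Context: All subcategories are full and closed under isomorphisms. A category is balanced if every morphism that is both a monomorphism and an epimorphism is an isomorphism. A category has epimorphic images if every morphism has an image (a smallest subobject of its codomain through which it factors) and the factorization of each morphism through its image is an epimorphism followed by a monomorphism. A morphism $\epsilon$ of $\mathcal{A}$ is an $H$-equivalence if $H(\epsilon)$ is an isomorphism. $\mathcal{C}_H\subseteq\mathcal{A}$ is the full subcategory of $H$-colocal objects, i.e. those $X$ such that for every $H$-equivalence $\epsilon:U\to V$ the map $\mathcal{A}(X,\epsilon):\mathcal{A}(X,U)\to\mathcal{A}(X,V)$ is bijective. $\mathcal{G}^T=\{Y\in\mathcal{B}\mid \eta_Y:Y\to(H\circ T)(Y)\text{ is a monomorphism}\}$. ''$T\dashv H$ induces mutually inverse equivalences $\mathcal{X}\rightleftarrows\mathcal{Y}$'' (for $\mathcal{X}\subseteq\mathcal{A}$, $\mathcal{Y}\subseteq\mathcal{B}$) means that $H$ restricts to a functor $\mathcal{X}\to\mathcal{Y}$, $T$ restricts to a functor $\mathcal{Y}\to\mathcal{X}$,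 and these restrictions are mutually quasi-inverse equivalences. *)

(* Defs.v *)
From mathcomp Require Import ssreflect ssrfun ssrbool.

Set Implicit Arguments.
Unset Strict Implicit.
Unset Printing Implicit Defensive.

Declare Scope category_scope.
Delimit Scope category_scope with cat.
Local Open Scope category_scope.

Record category := Category {
  ob :> Type;
  hom : ob -> ob -> Type;
  idm : forall X : ob, hom X X;
  compm : forall X Y Z : ob, hom Y Z -> hom X Y -> hom X Z;
  compm1 : forall (X Y : ob) (f : hom X Y), compm f (idm X) = f;
  comp1m : forall (X Y : ob) (f : hom X Y), compm (idm Y) f = f;
  compmA : forall (W X Y Z : ob) (h : hom Y Z) (g : hom X Y) (f : hom W X),
    compm h (compm g f) = compm (compm h g) f
}.

Arguments hom {c} X Y.
Arguments idm {c} X.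
Arguments compm {c X Y Z} g f.

Notation "g ∘ f" := (compm g f) (at level 40, left associativity)
  : category_scope.

Section Morphisms.
Variable C : category.

Definition is_iso (X Y : C) (f : hom X Y) : Prop :=
  exists g : hom Y X, g ∘ f = idm X /\ f ∘ g = idm Y.

Definition is_mono (X Y : C) (f : hom X Y) : Prop :=
  forall (W : C) (g h : hom W X), f ∘ g = f ∘ h -> g = h.

Definition is_epi (X Y : C) (f : hom X Y) : Prop :=
  forall (Z : C) (g h : hom Y Z), g ∘ f = h ∘ f -> g = h.

Definition factors_through (X I Y : C) (f : hom X Y) (m : hom I Y) : Prop :=
  exists e : hom X I, m ∘ e = f.

(* For monomorphisms [m] and [m'] into [Y], [factors_through m m'] is the order
   of subobjects of [Y]. *)
Definition is_image (X I Y : C) (f : hom X Y) (m : hom I Y) : Prop :=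
  [/\ is_mono m, factors_through f m &
      forall (J : C) (m' : hom J Y),
        is_mono m' -> factors_through f m' -> factors_through m m'].

End Morphisms.

Definition balanced (C : category) : Prop :=
  forall (X Y : C) (f : hom X Y), is_mono f -> is_epi f -> is_iso f.

Definition has_epimorphic_images (C : category) : Prop :=
  forall (X Y : C) (f : hom X Y),
    (exists (I : C) (m : hom I Y), is_image f m) /\
    (forall (I : C) (m : hom I Y) (e : hom X I),
       is_image f m -> m ∘ e = f -> is_epi e).

Record functor (C D : category) := Functor {
  fob :> C -> D;
  fmap : forall X Y : C, hom X Y -> hom (fob X) (fob Y);
  fmap1 : forall X : C, fmap (idm X) = idm (fob X);
  fmapM : forall (X Y Z : C) (g : hom Y Z) (f : hom X Y),
    fmap (g ∘ f) = fmap g ∘ fmap f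
}.

Arguments fmap {C D} F {X Y} f : rename.

Definition id_functor (C : category) : functor C C :=
  @Functor C C (fun X => X) (fun _ _ f => f) (fun _ => erefl)
    (fun _ _ _ _ _ => erefl).

Definition comp_functor (C D E : category)
    (G : functor D E) (F : functor C D) : functor C E :=
  @Functor C E (fun X => G (F X)) (fun _ _ f => fmap G (fmap F f))
    (fun X => etrans (congr1 (fmap G) (fmap1 F X)) (fmap1 G (F X)))
    (fun _ _ _ g f => etrans (congr1 (fmap G) (fmapM F g f))
                        (fmapM G (fmap F g) (fmap F f))).

Record nat_trans (C D : category) (F G : functor C D) := NatTrans {
  component :> forall X : C, hom (F X) (G X);
  naturality : forall (X Y : C) (f : hom X Y),
    component Y ∘ fmap F f = fmap G f ∘ component X
}.

Definition nat_isomorphic (C D : category) (F G : functor C D) : Prop :=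
  exists a : nat_trans F G, forall X : C, is_iso (a X).

Record adjunction (A B : category) (T : functor B A) (H : functor A B) :=
  Adjunction {
  adj_unit : nat_trans (id_functor B) (comp_functor H T);
  adj_counit : nat_trans (comp_functor T H) (id_functor A);
  triangle_left : forall Y : B, adj_counit (T Y) ∘ fmap T (adj_unit Y) = idm (T Y);
  triangle_right : forall X : A, fmap H (adj_counit X) ∘ adj_unit (H X) = idm (H X)
}.

Definition full_subcategory (C : category) (P : C -> Prop) : category :=
  @Category {X : C | P X} (fun X Y => hom (sval X) (sval Y))
    (fun X => idm (sval X)) (fun _ _ _ g f => g ∘ f)
    (fun _ _ f => compm1 f) (fun _ _ f => comp1m f)
    (fun _ _ _ _ h g f => compmA h g f).

Definition restrict_functor (C D : category) (F : functor C D)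
    (P : C -> Prop) (Q : D -> Prop) (FPQ : forall X : C, P X -> Q (F X)) :
    functor (full_subcategory P) (full_subcategory Q) :=
  @Functor (full_subcategory P) (full_subcategory Q)
    (fun X => exist Q (F (sval X)) (FPQ (sval X) (svalP X)))
    (fun X Y f => @fmap C D F (sval X) (sval Y) f)
    (fun X => fmap1 F (sval X))
    (fun _ _ _ g f => fmapM F g f).

Definition quasi_inverse (C D : category) (F : functor C D) (G : functor D C) :
    Prop :=
  nat_isomorphic (comp_functor G F) (id_functor C) /\
  nat_isomorphic (comp_functor F G) (id_functor D).

Definition induces_inverse_equivalences (A B : category)
    (T : functor B A) (H : functor A B) (P : A -> Prop) (Q : B -> Prop) : Prop :=
  exists (HPQ : forall X : A, P X -> Q (H X))
         (TQP : forall Y : B, Q Y -> P (T Y)),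
    quasi_inverse (restrict_functor HPQ) (restrict_functor TQP).

Definition equivalence_under (A B : category) (H : functor A B)
    (U V : A) (e : hom U V) : Prop :=
  is_iso (fmap H e).

Definition colocal (A B : category) (H : functor A B) (X : A) : Prop :=
  forall (U V : A) (e : hom U V), equivalence_under H e ->
    bijective (fun f : hom X U => e ∘ f).

Definition unit_mono (A B : category) (T : functor B A) (H : functor A B)
    (adj : adjunction T H) (Y : B) : Prop :=
  is_mono (adj_unit adj Y).

(* Main.v *)
(** If [η_Y = m ∘ e] is the epi-mono factorization of a unit component, then [I],
    the image, lies in [G^T], and [T e] is invertible: it is epi because [T] is a left
    adjoint and split mono because [ε_{TY} ∘ T m] retracts it.  An equivalence
    [C_H ⇄ G^T] makes [η_I] invertible, so [η_Y = (H T e)^-1 ∘ η_I ∘ e] is epi.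
    Conversely, if all [η_Y] are epi, balancedness makes [η_Y] invertible on [G^T],
    in particular at [Y = H X], so that every [ε_X] is an [H]-equivalence; between
    colocal objects [H]-equivalences are invertible. *)
From mathcomp Require Import ssreflect ssrfun ssrbool.
From Stdlib Require Import IndefiniteDescription.
Require Import Defs.

Set Implicit Arguments.
Unset Strict Implicit.
Unset Printing Implicit Defensive.

Local Open Scope category_scope.

Section Morphisms.
Variable C : category.

Lemma is_mono_comp (X Y Z : C) (g : hom Y Z) (f : hom X Y) :
  is_mono g -> is_mono f -> is_mono (g ∘ f).
Proof. by move=> gM fM W u v; rewrite -!compmA => /gM /fM. Qed.

Lemma is_mono_compl (X Y Z : C) (g : hom Y Z) (f : hom X Y) :
  is_mono (g ∘ f) -> is_mono f.
Proof. by move=> gfM W u v E; apply: gfM; rewrite -!compmA E. Qed.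

Lemma is_epi_comp (X Y Z : C) (g : hom Y Z) (f : hom X Y) :
  is_epi g -> is_epi f -> is_epi (g ∘ f).
Proof. by move=> gE fE W u v; rewrite !compmA => /fE /gE. Qed.

Lemma split_mono (X Y : C) (f : hom X Y) (r : hom Y X) :
  r ∘ f = idm X -> is_mono f.
Proof. by move=> rf W u v E; rewrite -(comp1m u) -(comp1m v) -rf -!compmA E. Qed.

Lemma split_epi (X Y : C) (f : hom X Y) (s : hom Y X) :
  f ∘ s = idm Y -> is_epi f.
Proof. by move=> fs W u v E; rewrite -(compm1 u) -(compm1 v) -fs !compmA E. Qed.

Lemma iso_mono (X Y : C) (f : hom X Y) : is_iso f -> is_mono f.
Proof. by case=> g [gf _]; apply: split_mono gf. Qed.

Lemma iso_epi (X Y : C) (f : hom X Y) : is_iso f -> is_epi f.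
Proof. by case=> g [_ fg]; apply: split_epi fg. Qed.

Lemma split_mono_epi_iso (X Y : C) (f : hom X Y) (r : hom Y X) :
  r ∘ f = idm X -> is_epi f -> is_iso f.
Proof.
move=> rf fE; exists r; split=> //.
by apply: fE; rewrite -compmA rf compm1 comp1m.
Qed.

Lemma iso_section (X Y : C) (f : hom X Y) (g : hom Y X) :
  is_iso f -> g ∘ f = idm X -> is_iso g.
Proof.
move=> fI gf; exists f; split=> //.
by apply: (iso_epi fI); rewrite -compmA gf compm1 comp1m.
Qed.

Lemma epi_mono_factorization :
  has_epimorphic_images C -> forall (X Y : C) (f : hom X Y),
  exists (I : C) (m : hom I Y) (e : hom X I), [/\ is_mono m, is_epi e & m ∘ e = f].
Proof.
move=> im X Y f; have [[I [m mI]] epi] := im X Y f.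
have [mM [e me] _] := mI.
by exists I, m, e; split=> //; apply: epi mI me.
Qed.

End Morphisms.

Lemma fmap_iso (C D : category) (F : functor C D) (X Y : C) (f : hom X Y) :
  is_iso f -> is_iso (fmap F f).
Proof.
case=> g [gf fg]; exists (fmap F g).
by rewrite -!fmapM gf fg !fmap1.
Qed.

(** Conjugating [G (F f)] by the natural isomorphism gives back [f]. *)
Lemma retraction_faithful (C D : category) (F : functor C D) (G : functor D C) :
  nat_isomorphic (comp_functor G F) (id_functor C) ->
  forall (X Y : C) (f g : hom X Y), fmap F f = fmap F g -> f = g.
Proof.
case=> a aI X Y f g E; apply: (iso_epi (aI X)).
have /= <- := naturality a f; have /= <- := naturality a g.
by rewrite E.
Qed.

(** Conjugating [G g] by the isomorphism [G F ≅ 1] gives the preimage; this is checked after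
    applying [G], which is faithful because [F G ≅ 1]. *)
Lemma quasi_inverse_full (C D : category) (F : functor C D) (G : functor D C) :
  quasi_inverse F G ->
  forall (X Y : C) (g : hom (F X) (F Y)), exists f : hom X Y, fmap F f = g.
Proof.
case=> -[a aI] FG X Y g; have [b [/= ba ab]] := aI X.
exists (a Y ∘ fmap G g ∘ b).
apply: (retraction_faithful FG); apply: (iso_mono (aI Y)).
have /= -> := naturality a (a Y ∘ fmap G g ∘ b).
by rewrite -compmA ba compm1.
Qed.

Lemma quasi_inverse_sym (C D : category) (F : functor C D) (G : functor D C) :
  quasi_inverse F G -> quasi_inverse G F.
Proof. by case. Qed.

(* Unique choice is needed to collect the pointwise inverses into one family. *)
Lemma nat_isomorphic_sym (C D : category) (F G : functor C D) :
  nat_isomorphic F G -> nat_isomorphic G F.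
Proof.
case=> a aI.
pose inv X := constructive_indefinite_description _ (aI X).
pose b X := proj1_sig (inv X).
have ba X : b X ∘ a X = idm (F X) by case: (proj2_sig (inv X)).
have ab X : a X ∘ b X = idm (G X) by case: (proj2_sig (inv X)).
have bN (X Y : C) (f : hom X Y) : b Y ∘ fmap G f = fmap F f ∘ b X.
  apply: (iso_mono (aI Y)).
  by rewrite !compmA ab comp1m naturality -compmA ab compm1.
by exists (NatTrans bN) => X; exists (a X).
Qed.

Section Adjunction.
Variables (A B : category) (T : functor B A) (H : functor A B).
Variable adj : adjunction T H.
Local Notation η := (adj_unit adj).
Local Notation ε := (adj_counit adj).

Lemma unitN (X Y : B) (f : hom X Y) : η Y ∘ f = fmap H (fmap T f) ∘ η X.
Proof. exact: naturality η X Y f. Qed.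

Lemma counitN (X Y : A) (f : hom X Y) : ε Y ∘ fmap T (fmap H f) = f ∘ ε X.
Proof. exact: naturality ε X Y f. Qed.

(** The transpose of [h] determines it: [h] is [ε X] after [T] of the transpose. *)
Lemma transpose_inj (Y : B) (X : A) (f g : hom (T Y) X) :
  fmap H f ∘ η Y = fmap H g ∘ η Y -> f = g.
Proof.
have tr (h : hom (T Y) X) : h = ε X ∘ fmap T (fmap H h ∘ η Y).
  by rewrite fmapM compmA counitN -compmA triangle_left compm1.
by move=> E; rewrite (tr f) (tr g) E.
Qed.

(** The transpose of [u ∘ T f] is the transpose of [u] composed with [f], and there [f] cancels. *)
Lemma left_adjoint_epi (X Y : B) (f : hom X Y) : is_epi f -> is_epi (fmap T f).
Proof.
move=> fE Z u v E; apply: transpose_inj; apply: fE.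
by rewrite -!compmA unitN !compmA -!fmapM E.
Qed.

Lemma colocal_left_adjoint (Y : B) : colocal H (T Y).
Proof.
move=> U V e [k [ke ek]].
(* Lifting along [e]: transpose, apply the inverse [k] of [H e], transpose back. *)
exists (fun f => ε U ∘ fmap T (k ∘ (fmap H f ∘ η Y))) => f /=.
- rewrite (fmapM H) -compmA [k ∘ _]compmA ke comp1m.
  by rewrite fmapM compmA counitN -compmA triangle_left compm1.
- rewrite compmA -counitN -compmA -fmapM [fmap H e ∘ _]compmA ek comp1m.
  by rewrite fmapM compmA counitN -compmA triangle_left compm1.
Qed.

Lemma unit_mono_right_adjoint (X : A) : unit_mono adj (H X).
Proof. exact: split_mono (triangle_right adj X). Qed.

(** Naturality makes [η X] the first factor of the monomorphism [η Y ∘ m]. *)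
Lemma unit_mono_subobject (X Y : B) (m : hom X Y) :
  is_mono m -> unit_mono adj Y -> unit_mono adj X.
Proof.
move=> mM YM; have := is_mono_comp YM mM.
by rewrite unitN; apply: is_mono_compl.
Qed.

Lemma colocal_equivalence_iso (U V : A) (e : hom U V) :
  colocal H U -> colocal H V -> equivalence_under H e -> is_iso e.
Proof.
move=> UC VC eH; have [g _ eg] := VC _ _ _ eH.
(* The inverse is the lift of the identity of [V] along [e]; the other composite is an identity
   because composing with [e] is injective on endomorphisms of [U]. *)
exists (g (idm V)); split; last exact: eg.
apply: (bij_inj (UC _ _ _ eH)).
by rewrite compmA eg comp1m compm1.
Qed.

Section InducedEquivalence.
Variables (P : A -> Prop) (Q : B -> Prop).

(** The given natural isomorphisms are arbitrary and need not involve [η]. They do make [T] fully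
    faithful on [Q], which suffices: the morphism that [T] sends to [ε (T Y)] is inverse to [η Y] by
    the triangle identities. *)
Lemma induced_equivalence_unit_iso :
  induces_inverse_equivalences T H P Q -> forall Y : B, Q Y -> is_iso (η Y).
Proof.
case=> HPQ [TQP /quasi_inverse_sym qi] Y QY.
pose Y' : full_subcategory Q := exist Q Y QY.
pose HTY' : full_subcategory Q := exist Q (H (T Y)) (HPQ _ (TQP _ QY)).
have [g /= Tg] := quasi_inverse_full qi (X := HTY') (Y := Y') (ε (T Y)).
exists g; split.
- apply: (retraction_faithful (proj1 qi) (X := Y') (Y := Y')) => /=.
  by rewrite fmapM fmap1 Tg triangle_left.
- by rewrite unitN Tg triangle_right.
Qed.

Lemma unit_counit_iso_induced_equivalence :
  (forall X : A, P X -> Q (H X)) -> (forall Y : B, Q Y -> P (T Y)) ->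
  (forall X : A, P X -> is_iso (ε X)) -> (forall Y : B, Q Y -> is_iso (η Y)) ->
  induces_inverse_equivalences T H P Q.
Proof.
move=> HPQ TQP εI ηI; exists HPQ, TQP; split.
- pose a := @NatTrans _ _
    (comp_functor (restrict_functor TQP) (restrict_functor HPQ)) (id_functor _)
    (fun X => ε (sval X)) (fun X Y f => counitN f).
  by exists a => X; apply: εI (svalP X).
(* [η] points from the identity to [H T], against the direction required here. *)
- apply: nat_isomorphic_sym.
  pose a := @NatTrans _ _ (id_functor _)
    (comp_functor (restrict_functor HPQ) (restrict_functor TQP))
    (fun Y => η (sval Y)) (fun X Y f => unitN f).
  by exists a => Y; apply: ηI (svalP Y).
Qed.

End InducedEquivalence.

Lemma unit_epi_of_unit_iso :
  has_epimorphic_images B ->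
  (forall Y : B, unit_mono adj Y -> is_iso (η Y)) ->
  forall Y : B, is_epi (η Y).
Proof.
move=> imB ηI Y.
have [I [m [e [mM eE me]]]] :=
  epi_mono_factorization imB (X := Y) (Y := H (T Y)) (η Y).
(* [I] is a subobject of [H (T Y)], whose unit component is a split monomorphism. *)
have IM := unit_mono_subobject mM (@unit_mono_right_adjoint (T Y)).
have TeI : is_iso (fmap T e).
  apply: (@split_mono_epi_iso _ _ _ _ (ε (T Y) ∘ fmap T m)).
  - by rewrite -compmA -(fmapM T m e) me; exact: (triangle_left adj Y).
  - exact: left_adjoint_epi.
have [k [kHTe _]] := fmap_iso H TeI.
have <- : k ∘ (η I ∘ e) = η Y by rewrite unitN compmA kHTe comp1m.
apply: is_epi_comp.
- by apply: iso_epi; apply: iso_section (fmap_iso H TeI) kHTe.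
- by apply: is_epi_comp eE; apply: iso_epi; apply: ηI.
Qed.

(** By the triangle identity [H (ε X)] is inverse to [η (H X)], so [ε X] is an [H]-equivalence
    between colocal objects. *)
Lemma counit_iso_of_unit_iso (X : A) :
  is_iso (η (H X)) -> colocal H X -> is_iso (ε X).
Proof.
move=> ηI XC; apply: colocal_equivalence_iso XC _.
- exact: colocal_left_adjoint.
- exact: iso_section ηI (triangle_right adj X).
Qed.

End Adjunction.

Theorem proposition2p10 (A B : category)
  (balA : balanced A) (balB : balanced B)
  (imA : has_epimorphic_images A) (imB : has_epimorphic_images B)
  (T : functor B A) (H : functor A B) (adj : adjunction T H) :
  induces_inverse_equivalences T H (colocal H) (unit_mono adj) <->
  (forall Y : B, is_epi (adj_unit adj Y)).
Proof.
split=> [eqv | ηE].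
- apply: unit_epi_of_unit_iso imB _.
  exact: induced_equivalence_unit_iso eqv.
- have ηI Y : unit_mono adj Y -> is_iso (adj_unit adj Y).
    by move=> ηM; apply: balB ηM (ηE Y).
  apply: (unit_counit_iso_induced_equivalence (adj := adj)) (ηI) => [X _ | Y _ | X].
  + exact: unit_mono_right_adjoint.
  + exact: colocal_left_adjoint adj Y.
  + apply: (counit_iso_of_unit_iso (adj := adj)).
    by apply: ηI; apply: unit_mono_right_adjoint.
Qed.
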